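(* Let $(X,d)$ be a complete metric space with $|X|\geq 3$ and let $T:X\to X$ be a mapping contracting triangles on $X$. Then $T$ has a fixed point if and only if $T$ does not possess periodic points of prime period $2$. The number of fixed points of $T$ is at most two.
   Context: Let $\Phi$ be the set of all functions $\varphi:[0,\infty)^3\to[0,\infty)$ satisfying: (1) $\varphi$ is symmetric, i.e. $\varphi(a,b,c)$ is invariant under all permutations of its three arguments, for all $a,b,c\in[0,\infty)$; (2) $\varphi$ is continuous; (3) $\varphi$ is non-decreasing (in each of its arguments); (4) there exists $k>0$ such that $ka\leq\varphi(a,b,c)$ for every $a,b,c\in[0,\infty)$; (5) $\varphi(a,b,c)=0$ if and only if $a=b=c=0$. Let $(X,d)$ be a metric space with $|X|\geq 3$. A map $T:X\to X$ is called a mapping contracting triangles on $X$ if there exist $\alpha\in[0,1)$ and $\varphi\in\Phi$ such that $$\varphi(d(Tx,Ty),d(Ty,Tz),d(Tz,Tx))\leq\alpha\,\varphi(d(x,y),d(y,z),d(x,z))$$ holds for all three pairwise distinct points $x,y,z\in X$. A point $x\in X$ is called a periodic point of period $n$ of $T$ if $T^nx=x$; the least positive integer $n$ for which $T^nx=x$ is called the prime period of $x$. *)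

(* Defs.v *)
From HB Require Import structures.
From mathcomp Require Import all_boot all_order all_algebra.
From mathcomp Require Import all_classical all_reals all_analysis.

Set Implicit Arguments.
Unset Strict Implicit.
Unset Printing Implicit Defensive.

Import Order.TTheory GRing.Theory Num.Theory.
Import numFieldTopology.Exports.

Local Open Scope classical_set_scope.
Local Open Scope ring_scope.

#[short(type="completeMetricType")]
HB.structure Definition CompleteMetric (K : numDomainType) :=
  { M of Metric K M & Complete M }.

(* A function [0, +oo)^3 -> [0, +oo) is represented by a total function
   R -> R -> R -> R of which only the values at nonnegative arguments matter:
   every condition below, continuity included, is relative to [0, +oo)^3. *)
Record in_Phi (R : realType) (phi : R -> R -> R -> R) : Prop := InPhi {
  Phi_ge0 : forall a b c, 0 <= a -> 0 <= b -> 0 <= c -> 0 <= phi a b c ;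
  Phi_sym : forall a b c, 0 <= a -> 0 <= b -> 0 <= c ->
    [/\ phi a c b = phi a b c, phi b a c = phi a b c, phi b c a = phi a b c,
        phi c a b = phi a b c & phi c b a = phi a b c] ;
  Phi_continuous :
    {within [set p : R * R * R | [/\ 0 <= p.1.1, 0 <= p.1.2 & 0 <= p.2]],
      continuous (fun p : R * R * R => phi p.1.1 p.1.2 p.2)} ;
  Phi_nondecreasing1 : forall a a' b c, 0 <= a -> 0 <= b -> 0 <= c ->
    a <= a' -> phi a b c <= phi a' b c ;
  Phi_nondecreasing2 : forall a b b' c, 0 <= a -> 0 <= b -> 0 <= c ->
    b <= b' -> phi a b c <= phi a b' c ;
  Phi_nondecreasing3 : forall a b c c', 0 <= a -> 0 <= b -> 0 <= c ->
    c <= c' -> phi a b c <= phi a b c' ;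
  Phi_lower_bound : exists2 k : R, 0 < k &
    forall a b c, 0 <= a -> 0 <= b -> 0 <= c -> k * a <= phi a b c ;
  Phi_eq0 : forall a b c, 0 <= a -> 0 <= b -> 0 <= c ->
    phi a b c = 0 <-> [/\ a = 0, b = 0 & c = 0]
}.

Definition contracting_triangles (R : realType) (X : metricType R)
    (T : X -> X) : Prop :=
  exists (alpha : R) (phi : R -> R -> R -> R),
    [/\ 0 <= alpha < 1, in_Phi phi &
      forall x y z : X, x != y -> y != z -> x != z ->
        phi (mdist (T x) (T y)) (mdist (T y) (T z)) (mdist (T z) (T x)) <=
        alpha * phi (mdist x y) (mdist y z) (mdist x z)].

Definition periodic_point (X : Type) (T : X -> X) (n : nat) (x : X) : Prop :=
  iter n T x = x.

Definition prime_period (X : Type) (T : X -> X) (n : nat) (x : X) : Prop :=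
  [/\ (0 < n)%N, periodic_point T n x &
    forall m : nat, (0 < m)%N -> periodic_point T m x -> (n <= m)%N].

(* Main.v *)
Require Import Defs.
From mathcomp Require Import all_boot all_order all_algebra.
From mathcomp Require Import all_classical all_reals all_analysis.
From mathcomp Require Import lra.

Import Order.TTheory GRing.Theory Num.Theory.
Import numFieldTopology.Exports.

Local Open Scope classical_set_scope.
Local Open Scope ring_scope.
Local Open Scope card_scope.

(** A contracted triangle cannot be mapped onto itself: by symmetry of phi both
    sides of the contraction inequality would then carry the same value v of
    phi, and v <= alpha * v forces v = 0, so that the three points coincide
    ([contracting_no_invariant_triangle]). Three fixed points, or a fixed point
    together with a 2-cycle, form such a triangle; this gives the bound on the
    number of fixed points and one direction of the equivalence.

    Conversely, suppose that T has neither fixed points nor 2-cycles. Then any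
    three consecutive points of an orbit u are pairwise distinct, so phi of the
    triangles (u n, u n.+1, u n.+2) decays like alpha ^+ n; the lower bound
    k * a <= phi a b c passes this decay on to the steps of the orbit, which
    therefore converges to some l ([cvg_geometric_steps]). For n large, u n and
    u n.+1 differ from l: if u n = l, then u n.+1 = T l, which stays at the
    positive distance D = mdist l (T l) from l. So the triangle
    (l, u n, u n.+1) is contracted; its sides tend to 0, hence so does its phi
    by continuity at the origin ([Phi_small]), hence so does the distance from
    T l to u n.+1. As u n.+1 tends to l, this yields T l = l, a contradiction
    ([contracting_fixed_point]). *)

Lemma cvg_geometric_steps (R : realType) (X : completeMetricType R)
    (u : nat -> X) (C a : R) :
  0 <= a < 1 -> (forall n, mdist (u n) (u n.+1) <= C * a ^+ n) ->
  cvg (u @ \oo).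
Proof.
move=> /andP[a0 a1] du.
have a1' : 0 < 1 - a by rewrite subr_gt0.
have C0 : 0 <= C by have := le_trans (mdist_ge0 _ _) (du 0%N); rewrite mulr1.
(* The sum of m consecutive terms of the geometric series, cleared of its
   denominator 1 - a. *)
have tail n m : (1 - a) * mdist (u n) (u (n + m)%N) <= C * a ^+ n * (1 - a ^+ m).
  elim: m => [|m IHm]; first by rewrite addn0 mdistxx subrr !mulr0.
  have := ler_wpM2l (ltW a1') (metric_triangle (u n) (u (n + m)%N) (u (n + m).+1)).
  have := ler_wpM2l (ltW a1') (du (n + m)%N).
  rewrite addnS exprS exprD; move: IHm.
  set p := a ^+ n; set q := a ^+ m; set x := mdist _ _; set y := mdist _ _.
  set z := mdist _ _ => H1 H2 H3; nra.
apply: cauchy_cvg; apply: cauchy_exP => e e0.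
have geo : geometric C a @ \oo --> (0 : R).
  by apply: cvg_geometric; rewrite ger0_norm.
have /cvgrPdist_lt/(_ ((1 - a) * e))[|N _ HN] := geo.
  by rewrite mulr_gt0.
have {HN} := HN N (leqnn N).
rewrite /= sub0r normrN ger0_norm ?mulr_ge0 ?exprn_ge0// => HN.
exists (u N); exists N => // m /= Nm; rewrite ballEmdist /=.
rewrite -(ltr_pM2l a1'); apply: le_lt_trans HN.
rewrite -(subnKC Nm); apply: le_trans (tail _ _) _.
by rewrite ler_piMr ?mulr_ge0 ?exprn_ge0// gerBl exprn_ge0.
Qed.

(** Only the period 1 has to be excluded, i.e. x must not be fixed. *)
Lemma prime_period2P (X : Type) (T : X -> X) (x : X) :
  prime_period T 2 x <-> T (T x) = x /\ T x <> x.
Proof.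
split=> [[_ TTx min2]|[TTx Tx]].
  by split=> // Tx; have := min2 1%N isT Tx.
by split=> // -[//|[|//]] _ /Tx.
Qed.

Lemma card_leI2 (T : Type) (A : set T) :
  (forall x y z, A x -> A y -> A z -> [\/ x = y, y = z | x = z]) ->
  A #<= `I_2.
Proof.
move=> A3; have [->|/set0P[x Ax]] := eqVneq A set0.
  exact: card_ge0.
have [y Axy] : exists y, A `<=` [set x; y].
  have [[y Ay xy]|Ax1] := pselect (exists2 y, A y & x <> y).
    by exists y => z Az; have [/xy|->|->] := A3 _ _ _ Ax Ay Az; [|right|left].
  by exists x => z Az; left; apply: contrapT => xz; apply: Ax1; exists z => // /esym.
pose f n := if n is 0%N then x else y.
apply: card_le_trans (card_image_le f `I_2); apply: subset_card_le => z /Axy.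
by case=> ->; [exists 0%N|exists 1%N].
Qed.

Section Phi.
Context {R : realType} {phi : R -> R -> R -> R} (Pphi : in_Phi phi).

Lemma Phi_le_contract0 (alpha a b c : R) : alpha < 1 ->
  0 <= a -> 0 <= b -> 0 <= c ->
  phi a b c <= alpha * phi a b c -> [/\ a = 0, b = 0 & c = 0].
Proof.
move=> alpha1 a0 b0 c0 le_phi; apply/(Phi_eq0 Pphi a0 b0 c0).
have := Phi_ge0 Pphi a0 b0 c0 => phi0.
nra.
Qed.

(** Continuity at the origin, where phi vanishes. *)
Lemma Phi_small (e : R) : 0 < e -> exists2 d : R, 0 < d &
  forall a b c, 0 <= a < d -> 0 <= b < d -> 0 <= c < d -> phi a b c < e.
Proof.
move=> e0.
have phi0 : phi 0 0 0 = 0 by apply/(Phi_eq0 Pphi).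
have /subspace_continuousP/(_ (0, 0, 0)) := Phi_continuous Pphi.
move=> /(_ (And3 (lexx _) (lexx _) (lexx _)))/cvgrPdist_lt/(_ e e0).
rewrite /within /= => /nbhs_ballP[d d0 Hd]; exists d => // a b c.
move=> /andP[a0 ad] /andP[b0 bd] /andP[c0 cd].
have := Hd (a, b, c); rewrite /from_subspace /= phi0 sub0r normrN.
move=> /(_ _ _)/(le_lt_trans (ler_norm _)); apply; last by split.
by split; [split|]; rewrite /ball /= sub0r normrN ger0_norm.
Qed.

End Phi.

(** The two cases are the permutations of x, y, z that fix x. *)
Lemma contracting_no_invariant_triangle (R : realType) (X : metricType R) (T : X -> X)
    (x y z : X) : contracting_triangles T -> x != y -> y != z -> x != z ->
  T x = x -> ~ ((T y = y /\ T z = z) \/ (T y = z /\ T z = y)).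
Proof.
move=> [alpha [phi [/andP[_ alpha1] Pphi ctr]]] xy yz xz Tx Tyz.
have d0 := @mdist_ge0 R X.
suff [/mdist_positivity/eqP + _ _] :
    [/\ mdist x y = 0, mdist y z = 0 & mdist x z = 0] by rewrite (negPf xy).
apply: (Phi_le_contract0 Pphi _ _ _ _ alpha1) => //.
have := ctr _ _ _ xy yz xz; rewrite Tx.
case: Tyz => -[-> ->]; first by rewrite (metric_sym z x).
rewrite (metric_sym z y) (metric_sym y x).
by have [_ _ _ _ ->] := Phi_sym Pphi (d0 x y) (d0 y z) (d0 x z).
Qed.

(** The hypothesis on T (T x) says that T has no point of prime period 2. *)
Lemma contracting_fixed_point (R : realType) (X : completeMetricType R) (T : X -> X) (x0 : X) :
  contracting_triangles T -> (forall x, T (T x) = x -> T x = x) ->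
  exists x, T x = x.
Proof.
move=> [alpha [phi [alpha01 Pphi ctr]]] T2.
have /andP[alpha0 alpha1] := alpha01.
have [k k0 kphi] := Phi_lower_bound Pphi.
have d0 := @mdist_ge0 R X.
apply: contrapT => nofix.
have T1 x : x != T x by apply/eqP => xTx; apply: nofix; exists x.
have TT x : x != T (T x) by apply/eqP => /esym/T2/esym/eqP; apply/negP.
pose u n := iter n T x0.
pose p n := phi (mdist (u n) (u n.+1)) (mdist (u n.+1) (u n.+2))
                (mdist (u n) (u n.+2)).
have pgeo n : p n <= p 0%N * alpha ^+ n.
  elim: n => [|n IHn]; first by rewrite mulr1.
  rewrite exprS mulrCA; apply: le_trans (ler_wpM2l alpha0 IHn).
  have := ctr (u n) (u n.+1) (u n.+2) (T1 _) (T1 _) (TT _).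
  by rewrite (metric_sym (T (u n.+2))).
have /cvg_ex[l ul] : cvg (u @ \oo).
  apply: (cvg_geometric_steps _ _ _ (p 0%N / k) alpha alpha01) => n.
  rewrite mulrAC ler_pdivlMr// mulrC.
  by apply: le_trans (pgeo n); exact: kphi.
pose D := mdist l (T l).
have D0 : 0 < D by rewrite mdist_gt0.
have near_l e : 0 < e -> \forall n \near \oo, mdist l (u n) < e.
  by move=> /(cvg_ball ul); rewrite ballEmdist.
have u_neq_l n : mdist l (u n.+1) < D -> u n != l.
  by move=> lu; apply/eqP => unl; move: lu; rewrite /= unl ltxx.
(* Once phi of the image triangle is below k * D / 2, T l is within D / 2 of
   u N.+1; together with mdist l (u N.+1) < D / 2 this contradicts the
   definition of D. *)
have kD0 : 0 < k * D / 2 by rewrite divr_gt0// mulr_gt0.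
have [e e0 small] := Phi_small Pphi _ kD0.
have [] := near_l (Num.min (D / 2) (e / 2)); first by rewrite lt_min !divr_gt0.
move=> N _ HN.
have {HN}close n : (N <= n)%N -> mdist l (u n) < D / 2 /\ mdist l (u n) < e / 2.
  by move=> /HN/=; rewrite lt_min => /andP[].
have [lN lNe] := close N (leqnn N).
have [lN1 lN1e] := close N.+1 (leqnSn N).
have [lN2 _] := close N.+2 (leq_trans (leqnSn N) (leqnSn _)).
have halfD : D / 2 < D by rewrite ltr_pdivrMr// ltr_pMr// ltr1n.
have halfe : e / 2 < e by rewrite ltr_pdivrMr// ltr_pMr// ltr1n.
have luN : l != u N by rewrite eq_sym u_neq_l// (lt_trans lN1).
have luN1 : l != u N.+1 by rewrite eq_sym u_neq_l// (lt_trans lN2).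
have := ctr l (u N) (u N.+1) luN (T1 _) luN1.
have /[swap]/le_lt_trans/[apply] :
    alpha * phi (mdist l (u N)) (mdist (u N) (u N.+1)) (mdist l (u N.+1)) <
    k * D / 2.
  apply: le_lt_trans (_ : phi (mdist l (u N)) (mdist (u N) (u N.+1))
      (mdist l (u N.+1)) < _).
    by rewrite ler_piMl ?(ltW alpha1)//; exact: (Phi_ge0 Pphi).
  apply: small; rewrite d0/=; [exact: lt_trans halfe| |exact: lt_trans halfe].
  apply: le_lt_trans (metric_triangle _ l _) _.
  by rewrite (metric_sym (u N)) [e]splitr ltrD.
move=> /(le_lt_trans (kphi _ _ _ (d0 _ _) (d0 _ _) (d0 _ _))).
rewrite -mulrA ltr_pM2l// ltNge => /negP; apply.
have := metric_triangle l (u N.+1) (T l); rewrite -/D (metric_sym _ (T l)) /=.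
move=> H; rewrite -(lerD2l (D / 2)) -splitr; apply: le_trans H _.
by rewrite lerD2r ltW.
Qed.

Theorem theorem2p1 (R : realType) (X : completeMetricType R) (T : X -> X)
    (card_X : `I_3 #<= [set: X]) (T_contr : contracting_triangles T) :
  ((exists x : X, T x = x) <-> ~ (exists x : X, prime_period T 2 x)) /\
  [set x : X | T x = x] #<= `I_2.
Proof.
split; first split.
- move=> [x Tx] [y /prime_period2P[TTy Ty]].
  have xy : x != y by apply/eqP => xy; apply: Ty; rewrite -xy.
  have xTy : x != T y by apply/eqP => xTy; apply: Ty; rewrite -xTy -TTy -xTy.
  have yTy : y != T y by apply/eqP => /esym.
  by apply: (contracting_no_invariant_triangle _ _ _ x y (T y) T_contr) => //; right.
- move=> no2; apply: (contracting_fixed_point _ _ _ point T_contr) => x TTx.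
  by apply: contrapT => Tx; apply: no2; exists x; apply/prime_period2P.
- apply: card_leI2 => x y z /= Tx Ty Tz.
  have [->|xy] := eqVneq x y; first by constructor 1.
  have [->|yz] := eqVneq y z; first by constructor 2.
  have [->|xz] := eqVneq x z; first by constructor 3.
  by exfalso; apply: (contracting_no_invariant_triangle _ _ _ x y z T_contr) => //; left.
Qed.
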